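(* Let $\alpha\in\{+,-\}$. A bidirected graph with vertex $r$ is an $\alpha$-semiradial with root $r$ if and only if it is a gluing sum $(G;s)\oplus(H;V(H))$, where $G$ is a member of $\mathcal{L}^{\alpha}(s)$ and $H$ is an absolute semiradial with root $r$ (with $G$ and $H$ disjoint).
   Context: A bidirected graph is a finite graph (loops and parallel edges allowed) in which each of the two ends of each edge carries a sign $+$ or $-$; we speak of the sign of $v$ over $e$ (a loop has two ends, each with its own sign). $-\alpha$ denotes the sign opposite to $\alpha$. A ditrail from $x$ to $y$ is a sequence $(v_0,e_1,v_1,\dots,e_k,v_k)$, $k\ge 0$, $v_0=x$, $v_k=y$, where the $e_i$ are pairwise distinct edges (vertices may repeat), $e_i$ joins $v_{i-1}$ and $v_i$, and for $1\le i<k$ the sign of the end of $e_i$ by which it arrives at $v_i$ is opposite to the sign of the end of $e_{i+1}$ by which it leaves $v_i$. If $k\ge1$ it is an $(\alpha,\beta)$-ditrail when the sign of $v_0$ over $e_1$ is $\alpha$ and the sign of $v_k$ over $e_k$ is $\beta$; the trivial ditrail ($k=0$) is regarded as both a $(+,-)$- and a $(-,+)$-ditrail. An $\alpha$-ditrail is an $(\alpha,+)$- or $(\alpha,-)$-ditrail. A closed ditrail over $r$ is a ditrail from $r$ to $r$. A bidirected graph $G$ with $r\in V(G)$ is an $\alpha$-radial (resp. $\alpha$-semiradial) with root $r$ if for every $v\in V(G)$ there is an $(\alpha,-\alpha)$-ditrail (resp. an $\alpha$-ditrail) from $v$ to $r$. It is an absolute semiradial with root $r$ if it is an $\alpha$-semiradial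 with root $r$ for each $\alpha\in\{+,-\}$. An $\alpha$-radial $G$ with root $r$ is almost strong if for every $v\in V(G)\setminus\{r\}$ there is a $(-\alpha,-\alpha)$-ditrail from $v$ to $r$, but there is no closed $(-\alpha,-\alpha)$-ditrail over $r$. An $\alpha$-semiradial $G$ with root $r$ is linear if it has no loop over $r$ and there is no $-\alpha$-ditrail from $x$ to $r$ for any $x\in V(G)$, except for the trivial ditrail from $r$ to $r$. Gluing sum. Let $G,H$ be disjoint bidirected graphs, $s\in V(G)$, $T\subseteq V(H)$. A gluing sum $(G;s)\oplus(H;T)$ is any bidirected graph $\hat G$ with $V(\hat G)=(V(G)\setminus\{s\})\cup V(H)$ whose edges are: all edges of $G$ not incident with $s$, all edges of $H$, and, for each edge $e$ of $G$ incident with $s$, exactly one edge $f(e)$ such that: if $e$ joins $s$ and $v\neq s$, then $f(e)$ joins some $t\in T$ and $v$, with the signs of $t$ and $v$ over $f(e)$ equal to the signs of $s$ and $v$ over $e$; if $e$ is a loop over $s$ with signs $\alpha_1,\alpha_2$, then $f(e)$ joins two (possibly identical) vertices of $T$ with signs $\alpha_1,\alpha_2$. (Gluing sums are not unique.) The sets $\mathcal{R}^{\alpha}(r)$ and $\mathcal{L}^{\alpha}(r)$ of bidirected graphs with vertex $r$ are defined simultaneously (for all vertex symbols $r$) as the smallest sets satisfying: (i) every almost strong $\alpha$-radial with root $r$ is in $\mathcal{R}^{\alpha}(r)$; (ii) every linear $\alpha$-semiradial with root $r$ is in $\mathcal{L}^{\alpha}(r)$; (iii) if $G\in\mathcal{R}^{\alpha}(r)$,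 then any bidirected graph obtained from $G$ by adding some edges of the form $rv$, $v\in V(G)$, in which $r$ has sign $\alpha$, is in $\mathcal{R}^{\alpha}(r)$; (iv) if $G\in\mathcal{L}^{\alpha}(s)$ and $H$ is an almost strong $\alpha$-radial with root $r$ with $V(G)\cap V(H)=\emptyset$, then any gluing sum $(G;s)\oplus(H;V(H)\setminus\{r\})$ is in $\mathcal{R}^{\alpha}(r)$; (v) if $G\in\mathcal{R}^{\alpha}(s)$ and $H$ is a linear $\alpha$-semiradial with root $r$ with $V(G)\cap V(H)=\emptyset$, then any gluing sum $(G;s)\oplus(H;V(H)\setminus\{r\})$ is in $\mathcal{L}^{\alpha}(r)$. *)

(* Defs.v *)
From mathcomp Require Import all_boot.

Set Implicit Arguments.
Unset Strict Implicit.
Unset Printing Implicit Defensive.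

(* Signs are booleans: true is +, false is -, and ~~ a is the opposite sign. *)
Notation sign := bool (only parsing).

(* ends e lists the two signed ends of e; the order in which they are listed
   is irrelevant, and edges are only accessed through the symmetric link. *)
Record bidigraph := Bidigraph {
  vertex :> finType;
  edge : finType;
  ends : edge -> (vertex * sign) * (vertex * sign)
}.

Definition link (G : bidigraph) (e : edge G) (p q : G * sign) : bool :=
  (ends e == (p, q)) || (ends e == (q, p)).

(* A step (p, e, q) leaves by the end p of e and arrives by its end q. Recording
   both ends fixes the direction in which a loop is traversed. *)
Definition step (G : bidigraph) : Type :=
  ((G * sign) * edge G * (G * sign))%type.

Section Ditrails.
Variable G : bidigraph.

Definition step_edge (t : step G) : edge G := t.1.2.
Definition departure (t : step G) : G * sign := t.1.1.
Definition arrival (t : step G) : G * sign := t.2.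

Definition is_step (t : step G) : bool :=
  link (step_edge t) (departure t) (arrival t).

Definition follows (t u : step G) : bool :=
  ((departure u).1 == (arrival t).1) && ((departure u).2 == ~~ (arrival t).2).

Definition ditrail (x y : G) (w : seq (step G)) : bool :=
  [&& all is_step w, uniq (map step_edge w), sorted follows w
    & if w is t :: w' then
        ((departure t).1 == x) && ((arrival (last t w')).1 == y)
      else x == y].

(* The trivial ditrail is both a (+,-)- and a (-,+)-ditrail. *)
Definition has_signs (a b : sign) (w : seq (step G)) : bool :=
  if w is t :: w' then
    ((departure t).2 == a) && ((arrival (last t w')).2 == b)
  else b == ~~ a.

Definition signed_ditrail (a b : sign) (x y : G) (w : seq (step G)) : bool :=
  ditrail x y w && has_signs a b w.

Definition half_signed_ditrail (a : sign) (x y : G) (w : seq (step G)) : bool :=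
  signed_ditrail a true x y w || signed_ditrail a false x y w.

Variables (a : sign) (r : G).

Definition radial : Prop :=
  forall v : G, exists w, signed_ditrail a (~~ a) v r w.

Definition semiradial : Prop :=
  forall v : G, exists w, half_signed_ditrail a v r w.

Definition almost_strong_radial : Prop :=
  [/\ radial,
      forall v : G, v != r -> exists w, signed_ditrail (~~ a) (~~ a) v r w
    & ~ exists w, signed_ditrail (~~ a) (~~ a) r r w].

Definition linear_semiradial : Prop :=
  [/\ semiradial,
      forall (e : edge G) (b c : sign), ~~ link e (r, b) (r, c)
    & forall (x : G) (w : seq (step G)), half_signed_ditrail (~~ a) x r w -> w = [::]].

End Ditrails.

Definition absolute_semiradial (G : bidigraph) (r : G) : Prop :=
  forall a : sign, semiradial a r.

(* gluing_sum s T jH says that Gh is a gluing sum (G; s) (+) (H; T), where jH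
   is the inclusion of V(H) into V(Gh). Disjointness of G and H is that of the
   sum types below; jG matters only outside s. The map f (inl e) is the edge
   f(e) if e is incident with s, and e itself otherwise. *)
Definition gluing_sum (G H Gh : bidigraph) (s : G) (T : {set H})
    (jH : H -> Gh) : Prop :=
  exists (jG : G -> Gh) (f : edge G + edge H -> edge Gh),
  [/\ bijective (fun x : {v : G | v != s} + H =>
        match x with inl v => jG (val v) | inr w => jH w end)
    & bijective f] /\
  [/\ forall (e : edge H) (u v : H) (b c : sign),
        link e (u, b) (v, c) -> link (f (inr e)) (jH u, b) (jH v, c),
      forall (e : edge G) (u v : G) (b c : sign), u != s -> v != s ->
        link e (u, b) (v, c) -> link (f (inl e)) (jG u, b) (jG v, c),
      forall (e : edge G) (v : G) (b c : sign), v != s ->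
        link e (s, b) (v, c) ->
        exists2 t : H, t \in T & link (f (inl e)) (jH t, b) (jG v, c)
    & forall (e : edge G) (b c : sign),
        link e (s, b) (s, c) ->
        exists t u : H,
          [/\ t \in T, u \in T & link (f (inl e)) (jH t, b) (jH u, c)]].

(* G' arises from G by adding edges rv in which r has sign a; jV identifies
   V(G) with V(G'). A new edge may be a loop over r, with an end of sign a. *)
Definition adds_root_edges (a : sign) (G G' : bidigraph) (r : G)
    (jV : G -> G') : Prop :=
  exists jE : edge G -> edge G',
  [/\ bijective jV, injective jE,
      forall (e : edge G) (u v : G) (b c : sign),
        link e (u, b) (v, c) -> link (jE e) (jV u, b) (jV v, c)
    & forall e' : edge G', e' \notin codom jE ->
        exists (v : G') (c : sign), link e' (jV r, a) (v, c)].

Inductive calR (a : sign) : forall G : bidigraph, G -> Prop :=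
| calR_almost_strong (G : bidigraph) (r : G) :
    almost_strong_radial a r -> calR a r
| calR_add_edges (G G' : bidigraph) (r : G) (jV : G -> G') :
    calR a r -> adds_root_edges a r jV -> calR a (jV r)
| calR_glue (G H Gh : bidigraph) (s : G) (r : H) (jH : H -> Gh) :
    calL a s -> almost_strong_radial a r ->
    gluing_sum s (~: [set r]) jH -> calR a (jH r)
with calL (a : sign) : forall G : bidigraph, G -> Prop :=
| calL_linear (G : bidigraph) (r : G) :
    linear_semiradial a r -> calL a r
| calL_glue (G H Gh : bidigraph) (s : G) (r : H) (jH : H -> Gh) :
    calR a s -> linear_semiradial a r ->
    gluing_sum s (~: [set r]) jH -> calL a (jH r).

(* Main.v *)
Require Import Defs.
From mathcomp Require Import all_boot zify.

(* The core of a graph with root r is the largest vertex set inside which every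
   vertex has ditrails to r of both signs (such sets are closed under union).
   The core of an a-semiradial induces an absolute semiradial, and contracting
   it leaves an a-semiradial G whose core is its root s alone. Such a G lies in
   L^a(s), by induction on the number of vertices. An edge sv must have sign a
   at v, and v has no (-a)-ditrail to s: otherwise v would lie in the core. Let X
   be the set of vertices with no (-a)-ditrail to s, and X' (the trunk) the set
   of those that reach s inside X. Then G[X'] is linear. In G/X', edges with sign
   a at the contracted root t lie on no ditrail arriving at t with sign -a, so
   they may be removed and restored by rule (iii). In the remaining graph every
   ditrail arrives at t with sign -a, hence its core induces an almost strong
   a-radial, and contracting that core gives a smaller graph of the same kind
   as G.
   Conversely, in a member of R^a(r) every vertex other than r has an
   (a,-a)-ditrail to r that meets r only at its end, so a ditrail arriving at the
   glued vertex always continues to the root of the other summand. *)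

Set Implicit Arguments.
Unset Strict Implicit.
Unset Printing Implicit Defensive.

(** * Walks *)

Section Walks.
Variable G : bidigraph.
Implicit Types (A B S : {set G}) (p q m : G * bool) (e : edge G)
  (es : seq (edge G)).

Definition neg p : G * bool := (p.1, ~~ p.2).

Lemma negK : involutive neg.
Proof. by case=> x b; rewrite /neg /= negbK. Qed.

Lemma linkC e p q : link e p q = link e q p.
Proof. by rewrite /link orbC. Qed.

(* A state (x, b) is a vertex x together with the sign b over the next edge;
   arriving at x with sign c thus leads to the state (x, ~~ c). Only the
   vertices from which an edge departs are required to lie in A, so that
   A = ~: B describes walks up to their first visit of B. *)
Fixpoint walk A p es q : bool :=
  if es is e :: es' then
    (p.1 \in A) && [exists m, link e p (neg m) && walk A m es' q]
  else p == q.

Lemma walk_consP A p e es q :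
  reflect [/\ p.1 \in A & exists2 m, link e p (neg m) & walk A m es q]
          (walk A p (e :: es) q).
Proof.
apply: (iffP andP) => [[pA /existsP[m /andP[]]]|[pA [m l w]]].
  by split=> //; exists m.
by split=> //; apply/existsP; exists m; rewrite l.
Qed.

Lemma walk_sub A B p es q : A \subset B -> walk A p es q -> walk B p es q.
Proof.
move=> /subsetP AB; elim: es p => //= e es IH p /andP[/AB-> /existsP[m]].
by case/andP=> l /IH w; apply/existsP; exists m; rewrite l.
Qed.

Lemma walk_cat A p es1 m es2 q :
  walk A p es1 m -> walk A m es2 q -> walk A p (es1 ++ es2) q.
Proof.
elim: es1 p => [p /eqP->//|e es1 IH p /walk_consP[pA [n l w1]] w2].
by apply/walk_consP; split=> //; exists n => //; apply: IH.
Qed.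

Lemma walk_rev A p es q :
  q.1 \in A -> walk A p es q -> walk A (neg q) (rev es) (neg p).
Proof.
move=> qA; elim: es p => [p /eqP->//=|e es IH p /walk_consP[pA [m l w]]].
rewrite rev_cons -cats1; apply: (walk_cat (IH _ w)).
have mA : m.1 \in A.
  by case: es {IH} w => [/eqP-> //|e' es /walk_consP[]].
by apply/walk_consP; split=> //; exists (neg p) => /=; rewrite // negK linkC.
Qed.

(** The basic cut: by [walk_outside] the first part has no edge inside [B], so any ditrail inside
    [B] can continue it without repeating an edge. *)
Lemma walk_first_hit A B p es q :
  q.1 \in B -> walk A p es q ->
  exists es1 m es2, [/\ es = es1 ++ es2, walk (A :\: B) p es1 m, m.1 \in B
    & walk A m es2 q].
Proof.
move=> qB; elim: es p => [p /eqP->|e es IH p w].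
  by exists [::], q, [::]; rewrite /= eqxx.
have [pB|pB] := boolP (p.1 \in B).
  by exists [::], p, (e :: es); split=> //=.
have [pA [n l /IH[es1 [m [es2 [-> w1 mB w2]]]]]] := walk_consP _ _ _ _ _ w.
exists (e :: es1), m, es2; split=> //; apply/walk_consP.
by rewrite inE pB; split=> //; exists n.
Qed.

Lemma walk_support A p es q :
  walk A p es q ->
  exists S, [/\ S \subset A, walk S p es q
    & forall u, u \in S -> exists es1 es2 b, [/\ es = es1 ++ es2, es2 != [::],
        walk S p es1 (u, b) & walk S (u, b) es2 q]].
Proof.
elim: es p => [p pq|e es IH p /walk_consP[pA [m l /IH[S [SA w H]]]]].
  by exists set0; split; rewrite ?sub0set // => u; rewrite inE.
have w' : walk (p.1 |: S) p (e :: es) q.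
  apply/walk_consP; rewrite setU11; split=> //; exists m => //.
  exact: walk_sub (subsetUr _ _) w.
exists (p.1 |: S); split=> [|//|u /setU1P[->|/H[es1 [es2 [b [-> n0 w1 w2]]]]]].
- by apply/subsetP=> u /setU1P[->//|]; apply/subsetP.
- by exists [::], (e :: es), p.2; rewrite -surjective_pairing; split=> //=.
exists (e :: es1), es2, b; split=> //; last exact: walk_sub (subsetUr _ _) w2.
apply/walk_consP; rewrite setU11; split=> //; exists m => //.
exact: walk_sub (subsetUr _ _) w1.
Qed.

Definition inside A e := ((ends e).1.1 \in A) && ((ends e).2.1 \in A).

Lemma inside_link A e p q :
  link e p q -> inside A e = (p.1 \in A) && (q.1 \in A).
Proof. by rewrite /inside => /orP[]/eqP->; rewrite // andbC. Qed.

Lemma walk_inside A p es q :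
  q.1 \in A -> walk A p es q -> all (inside A) es.
Proof.
move=> qA; elim: es p => //= e es IH p /andP[pA /existsP[m /andP[l w]]].
rewrite (IH _ w) (inside_link _ l) pA andbT /=.
by case: es {IH} w => [/eqP-> //|e' es /walk_consP[]].
Qed.

Lemma walk_outside A p es q :
  walk (~: A) p es q -> all (fun e => ~~ inside A e) es.
Proof.
elim: es p => //= e es IH p /andP[pA /existsP[m /andP[l w]]].
rewrite inE in pA.
by rewrite (IH _ w) (inside_link _ l) andbT (negPf pA).
Qed.

Lemma uniq_split_cat (P : pred (edge G)) es1 es2 :
  all (predC P) es1 -> all P es2 -> uniq es1 -> uniq es2 -> uniq (es1 ++ es2).
Proof.
move=> /allP P1 /allP P2 u1 u2; rewrite cat_uniq u1 u2 andbT /=.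
by apply/hasPn=> e /P2 Pe; apply/negP=> /P1; rewrite /= Pe.
Qed.

(** Bounding the length by the number of edges loses nothing, as the edges are distinct, and makes
    reachability boolean, so that it can define vertex sets. *)
Definition reach A p q :=
  [exists n : 'I_(#|edge G|).+1, [exists es : n.-tuple (edge G),
     uniq es && walk A p es q]].

Lemma reachP A p q :
  reflect (exists2 es, uniq es & walk A p es q) (reach A p q).
Proof.
apply: (iffP existsP) => [[n /existsP[es /andP[u w]]]|[es u w]].
  by exists es.
have lt : size es < (#|edge G|).+1 by rewrite ltnS -(card_uniqP u) max_card.
exists (Ordinal lt); apply/existsP; exists (in_tuple es).
by rewrite /= u.
Qed.

Lemma reach_refl A p : reach A p p.
Proof. by apply/reachP; exists [::] => /=. Qed.

Lemma reach_sub A B p q : A \subset B -> reach A p q -> reach B p q.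
Proof.
by move=> AB /reachP[es u w]; apply/reachP; exists es => //; apply: walk_sub w.
Qed.

(** Each edge of the first ditrail departs from outside [A], while all edges of the second lie
    inside [A]; hence none is repeated. *)
Lemma reach_cat A B C p m q :
  B \subset C :\: A -> A \subset C -> q.1 \in A ->
  reach B p m -> reach A m q -> reach C p q.
Proof.
rewrite subsetD => /andP[BC dBA] AC qA /reachP[es1 u1 w1] /reachP[es2 u2 w2].
apply/reachP; exists (es1 ++ es2).
  apply: uniq_split_cat u1 u2; last exact: walk_inside w2.
  by apply: walk_outside (walk_sub _ w1); rewrite -disjoints_subset.
exact: walk_cat (walk_sub BC w1) (walk_sub AC w2).
Qed.

(** * Translation between ditrails and walks *)

Lemma signed_ditrail_walk (b c : bool) (x y : G) w :
  signed_ditrail b c x y w ->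
  uniq (map (@step_edge G) w) /\
  walk [set: G] (x, b) (map (@step_edge G) w) (y, ~~ c).
Proof.
case: w => [|t w] /andP[/and4P[/= st u so]].
  by move=> /eqP-> /eqP->; rewrite negbK.
move=> /andP[/eqP <- /eqP <-] /andP[/eqP<- /eqP<-]; split=> //; clear u.
rewrite -surjective_pairing -/(neg _).
elim: w t st so => [|t' w IH] t /=; rewrite inE /=.
  rewrite andbT => st _; apply/existsP; exists (neg (arrival t)).
  by rewrite negK eqxx andbT.
case/and3P=> st st' sw /andP[/andP[/eqP f1 /eqP f2] so].
apply/existsP; exists (departure t').
have -> : neg (departure t') = arrival t.
  by rewrite /neg f1 f2 negbK -surjective_pairing.
rewrite -/(is_step t) st /=; apply: IH => //=.
by rewrite st'.
Qed.

Lemma walk_signed_ditrail (b c : bool) (x y : G) es :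
  uniq es -> walk [set: G] (x, b) es (y, ~~ c) ->
  exists2 w, signed_ditrail b c x y w & map (@step_edge G) w = es.
Proof.
move=> u w0.
suff [w [mw st so H]] : exists w, [/\ map (@step_edge G) w = es,
   all (@is_step G) w, sorted (@follows G) w &
   if w is t :: w' then departure t = (x, b) /\ arrival (last t w') = (y, c)
   else (x, b) = (y, ~~ c)].
  exists w => //; rewrite /signed_ditrail /ditrail mw u st so /=.
  case: w H {mw st so} => [[-> ->]|t w [d ar]]; first by rewrite /= negbK !eqxx.
  by rewrite /= d ar /= !eqxx.
elim: es x b {u} w0 => [|e es IH] x b /=; first by move/eqP=> eq; exists [::].
case/andP=> _ /existsP[m /andP[l]]; rewrite {1}[m]surjective_pairing.
case/IH=> w [mw st so H].
exists ((x, b, e, neg m) :: w); split=> /=; rewrite ?mw ?st ?andbT //.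
  case: w H so {mw st} => //= t w [d ar] so.
  by rewrite so andbT /follows d /= negbK !eqxx.
case: w H {mw st so} => /= [H|t w [_ H]]; split=> //.
by rewrite [m]surjective_pairing H /neg /= negbK.
Qed.

(** Arrival with sign [c] is the final state with sign [~~ c]. The trivial ditrail fits: its only
    state has sign [b], and [has_signs] asks for [c = ~~ b]. *)
Lemma signed_ditrailP (b c : bool) (x y : G) :
  (exists w, signed_ditrail b c x y w) <-> reach [set: G] (x, b) (y, ~~ c).
Proof.
split=> [[w /signed_ditrail_walk[u ?]]|/reachP[es u]].
  by apply/reachP; exists (map (@step_edge G) w).
by case/(walk_signed_ditrail u)=> w ? _; exists w.
Qed.

Lemma half_signed_ditrailP (b : bool) (x y : G) :
  (exists w, half_signed_ditrail b x y w)
    <-> exists c, reach [set: G] (x, b) (y, c).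
Proof.
split=> [[w /orP[]/signed_ditrail_walk[u H]]|[c]].
- by exists false; apply/reachP; exists (map (@step_edge G) w).
- by exists true; apply/reachP; exists (map (@step_edge G) w).
rewrite -[c]negbK => /signed_ditrailP[w H]; exists w; move: H.
by rewrite /half_signed_ditrail; case: (~~ c) => ->; rewrite ?orbT.
Qed.

End Walks.
(** * Induced subgraphs and contractions *)

Lemma walk_hom (G H : bidigraph) (j : H -> G) (f : edge H -> edge G)
    (A : {set H}) (B : {set G}) p es q :
  (forall e p q, link e p q -> link (f e) (j p.1, p.2) (j q.1, q.2)) ->
  (forall x, x \in A -> j x \in B) ->
  walk A p es q -> walk B (j p.1, p.2) (map f es) (j q.1, q.2).
Proof.
move=> fl AB; elim: es p => [p /eqP->|e es IH p /walk_consP[pA [m l w]]] /=.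
  exact: eqxx.
apply/andP; split; first exact: AB.
by apply/existsP; exists (j m.1, m.2); rewrite (fl _ _ _ l) IH.
Qed.

Section Quotients.
Variables (G : bidigraph) (V : finType) (h : G -> V) (D : pred (edge G)).

Definition himg (p : G * bool) : V * bool := (h p.1, p.2).

(** Covers induced subgraphs, with [h] a retraction onto the kept vertices, as well as contractions,
    with [h] collapsing a set; [D] selects the surviving edges. *)
Definition quot : bidigraph :=
  @Bidigraph V {e : edge G | D e}
    (fun e => (himg (ends (val e)).1, himg (ends (val e)).2)).

Lemma quot_link (e : edge quot) p q :
  link (val e) p q -> @link quot e (himg p) (himg q).
Proof.
by rewrite /link /= => /orP[]/eqP->; rewrite eqxx ?orbT.
Qed.

Lemma link_quot (e : edge quot) p q :
  @link quot e p q ->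
  exists p0 q0, [/\ himg p0 = p, himg q0 = q & link (val e) p0 q0].
Proof.
have E : ends (val e) = ((ends (val e)).1, (ends (val e)).2).
  exact: surjective_pairing.
rewrite /link /= => /orP[]/eqP[<- <-].
  by exists (ends (val e)).1, (ends (val e)).2; rewrite -E eqxx.
by exists (ends (val e)).2, (ends (val e)).1; rewrite -E eqxx orbT.
Qed.

Lemma walk_quot (A : {set G}) (B : {set V}) p es q :
  (forall x, x \in A -> h x \in B) -> all D es -> walk A p es q ->
  exists2 es', map val es' = es & @walk quot B (himg p) es' (himg q).
Proof.
move=> AB; elim: es p => [p _ /eqP->|e es IH p /= /andP[De Des]].
  by exists [::] => //=.
case/andP=> pA /existsP[m /andP[l w]].
have [es' Ees' w'] := IH m Des w.
exists (Sub e De :: es'); first by rewrite /= Ees'.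
apply/walk_consP; split; first exact: AB.
by exists (himg m) => //; apply: (@quot_link (Sub e De) p (neg m)).
Qed.

Lemma reach_quot (A : {set G}) (B : {set V}) p q :
  (forall x, x \in A -> h x \in B) ->
  (forall es, walk A p es q -> all D es) ->
  reach A p q -> @reach quot B (himg p) (himg q).
Proof.
move=> AB AD /reachP[es u w]; have [es' E w'] := walk_quot AB (AD _ w) w.
by apply/reachP; exists es' => //; rewrite -(map_inj_uniq val_inj) E.
Qed.

(** Only departures have to lie in [B], where [h] is injective, so the lift may still end in a
    collapsed set. *)
Lemma quot_lift (B : {set V}) p' es q' p :
  (forall x y, h x \in B -> h x = h y -> x = y) ->
  @walk quot B p' es q' -> himg p = p' ->
  exists2 q, himg q = q' & walk (h @^-1: B) p (map val es) q.
Proof.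
move=> inj; elim: es p' p => [p' p /eqP->|e es IH p' p].
  by move=> E; exists p => //=.
case/walk_consP=> pB [m' l w] E.
have [p0 [m0 [E0 Em l0]]] := link_quot l.
have hB : h p.1 \in B by rewrite -E in pB.
have Ep : p0 = p.
  move: E; rewrite -E0 => -[E1 E2].
  by rewrite [p0]surjective_pairing -E2 -(inj _ _ hB E1) -surjective_pairing.
have Em' : himg (neg m0) = m'.
  by rewrite -[m']negK -Em.
have [q Eq wq] := IH _ _ w Em'; exists q => //.
rewrite map_cons; apply/walk_consP; rewrite inE hB; split=> //.
by exists (neg m0); rewrite // negK -Ep.
Qed.

End Quotients.

Lemma inj_surj_bij (S T : finType) (f : S -> T) :
  injective f -> (forall y, exists x, f x = y) -> bijective f.
Proof.
move=> fi fs; apply: (inj_card_bij fi); rewrite -(card_codom fi).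
apply: subset_leq_card; apply/subsetP=> y _.
by have [x <-] := fs y; apply: codom_f.
Qed.

Section Minors.
Variables (G : bidigraph) (A : {set G}).

(** The root serves as the default of [insubd], making the vertex map total; kept edges have both
    ends in [A], where [insubd] inverts [val]. *)
Definition induced (r : {x : G | x \in A}) : bidigraph :=
  quot (fun x => insubd r x) (inside A).

(* The vertex A is contracted to is None. *)
Definition coll (x : G) : option {x : G | x \notin A} := insub x.

Definition contract : bidigraph := quot coll (fun e => ~~ inside A e).

Lemma coll_eqNone x : (coll x == None) = (x \in A).
Proof. by rewrite /coll; case: insubP => [u /negPf->|/negPn->]. Qed.

Lemma coll_inj x y : coll x != None -> coll x = coll y -> x = y.
Proof.
rewrite /coll; case: insubP => // u _ <- _; case: insubP => // v _ <- [->] //.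
Qed.

Lemma coll_val (u : {x : G | x \notin A}) : coll (val u) = Some u.
Proof. by rewrite /coll valK. Qed.

Lemma coll_None x : x \in A -> coll x = None.
Proof. by rewrite -coll_eqNone => /eqP. Qed.

Lemma coll_himg_lift D (B : {set option {x : G | x \notin A}}) p' es q' p :
  None \notin B -> @walk (quot coll D) B p' es q' -> himg coll p = p' ->
  exists2 q, himg coll q = q' & walk (coll @^-1: B) p (map val es) q.
Proof.
move=> nB; apply: quot_lift => x y xB; apply: coll_inj.
by apply: contraNneq nB => <-.
Qed.

Lemma contract_loop D (e : edge (quot coll D)) b c :
  (forall e, D e -> ~~ inside A e) ->
  ~~ @link (quot coll D) e (None, b) (None, c).
Proof.
move=> DA; apply/negP=> /link_quot[p [q [[/eqP]]]].
rewrite coll_eqNone => pA _ [/eqP]; rewrite coll_eqNone => qA _ l.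
by have := DA _ (valP e); rewrite (inside_link _ l) pA qA.
Qed.

Section Induced.
Variable r : {x : G | x \in A}.

Lemma induced_link (e : edge (induced r)) p q :
  link e p q -> link (val e) (val p.1, p.2) (val q.1, q.2).
Proof.
case/link_quot=> p0 [q0 [<- <- l]]; have := valP e.
rewrite (inside_link _ l) => /andP[pA qA].
by rewrite /= !val_insubd pA qA -!surjective_pairing.
Qed.

Lemma reach_induced (u v : induced r) b c :
  reach A (val u, b) (val v, c) -> reach [set: induced r] (u, b) (v, c).
Proof.
have E (x : induced r) d : (x, d) = himg (fun x => insubd r x) (val x, d).
  by rewrite /himg /= valKd.
rewrite !E; apply: reach_quot => [x _|es w]; first by rewrite inE.
by apply: (walk_inside _ w); apply: valP.
Qed.

Lemma induced_reach (u v : induced r) b c :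
  reach [set: induced r] (u, b) (v, c) -> reach A (val u, b) (val v, c).
Proof.
case/reachP=> es ue w; apply/reachP; exists (map val es).
  by rewrite (map_inj_uniq val_inj).
by apply: walk_hom induced_link _ w => x _; apply: valP.
Qed.

(** Gluing undoes contraction: edges inside [A] come from the induced subgraph, all others from the
    contraction, whose vertex [None] carries no loop. *)
Lemma gluing_sum_contract (T : {set induced r}) :
  (forall e (u : induced r) v b c, v \notin A ->
     link e (val u, b) (v, c) -> u \in T) ->
  @gluing_sum contract (induced r) G None T val.
Proof.
move=> HT.
pose jG (v : contract) : G := if v is Some u then val u else val r.
pose f (e : edge contract + edge (induced r)) : edge G :=
  match e with inl e => val e | inr e => val e end.
have jG_coll x : x \notin A -> jG (coll x) = x.
  by move=> xA; rewrite /coll insubT.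
exists jG, f; split; [split; apply: inj_surj_bij|split].
- move=> [[[u|] //= u0]|u] [[[v|] //= v0]|v].
  + by move=> E; congr inl; apply: val_inj; congr Some; apply: val_inj.
  + by move=> E; case/negP: (valP u); rewrite /= E; apply: valP.
  + by move=> E; case/negP: (valP v); rewrite /= -E; apply: valP.
  by move/val_inj->.
- move=> x; have [xA|xA] := boolP (x \in A).
    by exists (inr (Sub x xA)); rewrite SubK.
  by exists (inl (Sub (Some (Sub x xA)) isT)).
- move=> [u|u] [v|v] /=.
  + by move/val_inj->.
  + by move=> E; case/negP: (valP u); rewrite /= E; apply: valP.
  + by move=> E; case/negP: (valP v); rewrite /= -E; apply: valP.
  by move/val_inj->.
- move=> e; have [eA|eA] := boolP (inside A e).
    by exists (inr (Sub e eA)).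
  by exists (inl (Sub e eA)).
- by move=> e u v b c /induced_link.
- move=> e u v b c u0 v0 /link_quot[[x b'] [[y c'] [[Ex <-] [Ey <-] l]]].
  by rewrite -Ex -Ey !jG_coll // -coll_eqNone ?Ex ?Ey.
- move=> e v b c v0 /link_quot[[x b'] [[y c'] [[/eqP xA <-] [Ey <-] l]]].
  rewrite coll_eqNone in xA.
  have yA : y \notin A by rewrite -coll_eqNone Ey.
  exists (Sub x xA); first exact: (HT _ (Sub x xA) _ _ _ yA l).
  by rewrite -Ey jG_coll.
- by move=> e b c; rewrite (negPf (contract_loop _ _ _ _)).
Qed.

End Induced.

End Minors.
(** * The core *)

Section Absolute.
Variables (G : bidigraph) (r : G).

Definition absolute (A : {set G}) :=
  (r \in A) && [forall v in A, forall b, exists c, reach A (v, b) (r, c)].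

Lemma absoluteP (A : {set G}) :
  reflect (r \in A /\ forall v b, v \in A -> exists c, reach A (v, b) (r, c))
          (absolute A).
Proof.
apply: (iffP andP) => -[rA H]; split=> //.
  by move=> v b vA; have /forallP/(_ b)/existsP := forall_inP H _ vA.
by apply/forall_inP=> v vA; apply/forallP=> b; apply/existsP; apply: H.
Qed.

Definition core : {set G} := \bigcup_(A | absolute A) A.

Lemma sub_core A : absolute A -> A \subset core.
Proof. by move=> HA; apply: (bigcup_sup A). Qed.

Lemma core_root : r \in core.
Proof.
apply: (subsetP (@sub_core [set r] _)); last exact: set11.
apply/absoluteP; rewrite set11; split=> // v b /set1P->.
by exists b; apply: reach_refl.
Qed.

Lemma absolute_core : absolute core.
Proof.
apply/absoluteP; split=> [|v b /bigcupP[A HA vA]]; first exact: core_root.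
have [_ /(_ v b vA)[c]] := absoluteP _ HA.
by exists c; apply: reach_sub (sub_core HA) _.
Qed.

Lemma core_semiradial (r0 : {x : G | x \in core}) :
  val r0 = r -> absolute_semiradial (r0 : induced r0).
Proof.
move=> Er b v; apply/half_signed_ditrailP.
have [_ /(_ (val v) b (valP v))[c H]] := absoluteP _ absolute_core.
by exists c; apply: reach_induced; rewrite Er.
Qed.

(* If P leaves v with the sign opposite to that of e, then following e from r
   to v, then P, visits every vertex once with each sign, seen from the two
   directions, even if e is also the last edge of P. *)
Lemma adjacent_core e v g c :
  v != r -> link e (v, g) (r, c) ->
  (exists d, reach [set: G] (v, ~~ g) (r, d)) -> v \in core.
Proof.
move=> vr l [d /reachP[es0 u0 w0]].
have [es [m [es2 [Ees w mr _]]]] :=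
  walk_first_hit (q := (r, d)) (set11 r) w0.
have u : uniq es by move: u0; rewrite Ees cat_uniq => /and3P[].
have {w} [S [SA w HS]] := walk_support w.
have vS : v \in S.
  case: es w {Ees u HS} => [/eqP E|e' es /walk_consP[]//].
  by rewrite -E inE (negPf vr) in mr.
have SrD : S \subset ~: [set r].
  by apply: subset_trans SA _; rewrite setTD.
have Em : m = (r, m.2) by rewrite [LHS]surjective_pairing (set1P mr).
apply: (subsetP (@sub_core (r |: S) _)); last by rewrite inE vS orbT.
apply/absoluteP; split=> [|x b]; first by rewrite setU11.
case/setU1P=> [->|xS]; first by exists b; apply: reach_refl.
have [es1 [es3 [b' [E _ w1 w3]]]] := HS x xS.
have [u1 u3] : uniq es1 /\ uniq es3 by move: u; rewrite E cat_uniq => /and3P[].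
have [->|nb] := eqVneq b b'.
  exists m.2; rewrite -Em; apply/reachP; exists es3 => //.
  exact: walk_sub (subsetUr _ _) w3.
have -> : (x, b) = neg (x, b') by rewrite /neg /=; case: b b' nb {w1 w3} => -[].
(* Back along the walk to [v], then over [e]. The part [es1] stays inside [S], which avoids [r], so
   it does not contain [e]. *)
exists (~~ c); apply/reachP; exists (rev es1 ++ [:: e]).
  rewrite cats1 rcons_uniq rev_uniq u1 andbT mem_rev; apply/negP=> ees1.
  have := walk_inside (q := (x, b')) (A := S) xS w1.
  move/allP/(_ e ees1); rewrite (inside_link _ l) /= => /andP[_ rS].
  by have := subsetP SrD _ rS; rewrite !inE eqxx.
have w1' := walk_rev (q := (x, b')) xS w1.
apply: (walk_cat (walk_sub (subsetUr _ _) w1')).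
apply/walk_consP; split; first by rewrite /= inE vS orbT.
by exists (r, ~~ c); rewrite /neg /= ?negbK.
Qed.

End Absolute.

(** The preimage of the core of the quotient is absolute in [G]: a ditrail lifts up to its first
    visit of [None], which is a vertex of [A], and continues to [r] inside [A]. Maximality of the
    core confines this preimage to [A]. *)
Lemma core_contract (G : bidigraph) (r : G) (D : pred (edge G)) :
  (forall e, D e -> ~~ inside (core r) e) ->
  core (None : quot (coll (core r)) D) = [set None].
Proof.
move=> DA; set A := core r in DA *; set Q := quot _ _; set B := core _.
have /absoluteP[NB HB] := absolute_core (None : Q).
have [rA HA] := absoluteP _ _ (absolute_core r).
suff CA : coll A @^-1: B \subset A.
  apply/setP=> -[u|]; rewrite !inE ?NB //=; apply/negP=> uB.
  have /(subsetP CA) : val u \in coll A @^-1: B by rewrite inE coll_val.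
  by apply/negP; apply: (valP u).
have AC : A \subset coll A @^-1: B.
  by apply/subsetP=> x xA; rewrite inE coll_None.
apply/sub_core/absoluteP; split=> [|v b]; first by rewrite inE coll_None.
rewrite inE => vB; have [c /reachP[es0 u0 w0]] := HB _ b vB.
have [es [m [es2 [Ees w /set1P mN _]]]] :=
  walk_first_hit (q := (None : Q, c)) (set11 _) w0.
have u : uniq es by move: u0; rewrite Ees cat_uniq => /and3P[].
have nB : None \notin B :\: [set None] by rewrite !inE eqxx.
have [q Eq wq] := coll_himg_lift (p := (v, b)) nB w erefl.
have qA : q.1 \in A.
  by rewrite -coll_eqNone -[coll A _]/(himg (coll A) q).1 Eq mN.
have [c' Hc'] := HA _ q.2 qA.
exists c'.
apply: (@reach_cat _ A (coll A @^-1: (B :\: [set None])) _ _ q) => //.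
- rewrite subsetD; apply/andP; split.
    by apply: preimsetS; apply: subsetDl.
  rewrite disjoints_subset; apply/subsetP=> x; rewrite !inE => /andP[xN _].
  by rewrite -coll_eqNone.
- by apply/reachP; exists (map val es); rewrite // (map_inj_uniq val_inj).
by rewrite -surjective_pairing in Hc'.
Qed.
(** * Semiradials with trivial core *)

Lemma semiradialP (G : bidigraph) (a : bool) (r : G) :
  semiradial a r <-> forall v, exists c, reach [set: G] (v, a) (r, c).
Proof. by split=> H v; apply/half_signed_ditrailP; apply: H. Qed.

Lemma semiradial_contract (G : bidigraph) (a : bool) (r : G) (A : {set G}) :
  r \in A -> semiradial a r -> semiradial a (None : contract A).
Proof.
move=> rA /semiradialP H; apply/semiradialP=> -[u|]; last first.
  by exists a; apply: reach_refl.
have [c /reachP[es0 u0 w0]] := H (val u).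
have [es [m [es2 [Ees w mA _]]]] := walk_first_hit (q := (r, c)) rA w0.
have ue : uniq es by move: u0; rewrite Ees cat_uniq => /and3P[].
exists m.2; have <- : himg (coll A) m = (None, m.2) by rewrite /himg coll_None.
have <- : himg (coll A) (val u, a) = (Some u, a) by rewrite /himg coll_val.
apply: (@reach_quot _ _ _ _ (~: A)) => [x _|es' w'|]; first by rewrite inE.
  exact: walk_outside w'.
by apply/reachP; exists es => //; move: w; rewrite setTD.
Qed.

(** Beyond the edges inside [A], this drops exactly those that [calR_add_edges] can restore at the
    contracted vertex. *)
Definition trim (G : bidigraph) (a : bool) (A : {set G}) : pred (edge G) :=
  fun e => let: (p, q) := ends e in
  [&& ~~ ((p.1 \in A) && (q.1 \in A)), ~~ ((p.1 \in A) && (p.2 == a))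
    & ~~ ((q.1 \in A) && (q.2 == a))].

Lemma trim_link (G : bidigraph) (a : bool) (A : {set G}) (e : edge G) p q :
  link e p q -> trim a A e =
  [&& ~~ ((p.1 \in A) && (q.1 \in A)), ~~ ((p.1 \in A) && (p.2 == a))
    & ~~ ((q.1 \in A) && (q.2 == a))].
Proof.
rewrite /trim /link => /orP[]/eqP-> //.
by congr andb; [rewrite andbC | rewrite andbC].
Qed.

Lemma trim_outside (G : bidigraph) (a : bool) (A : {set G}) (e : edge G) :
  trim a A e -> ~~ inside A e.
Proof. by rewrite /trim /inside; case: (ends e) => p q /and3P[]. Qed.

(** Such a walk meets [A] only by its last arrival, and there the state sign [a] means arrival with
    sign [~~ a]. *)
Lemma walk_trim (G : bidigraph) (a : bool) (A : {set G}) p es m :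
  m.1 \in A -> m.2 = a -> walk (~: A) p es m -> all (trim a A) es.
Proof.
move=> mA ma; elim: es p => //= e es IH p /andP[pA /existsP[n /andP[l w]]].
rewrite (IH _ w) andbT (trim_link _ _ l) /=; rewrite inE in pA.
rewrite (negPf pA) /=; apply/nandP.
case: es {IH} w => [/eqP->|e' es /walk_consP[]]; last by rewrite inE; left.
by right; rewrite ma; case: (a).
Qed.

Lemma trim_link_None (G : bidigraph) (a : bool) (A : {set G})
    (e : edge (quot (coll A) (trim a A))) p c :
  @link (quot (coll A) (trim a A)) e p (None, c) -> c = ~~ a.
Proof.
case/link_quot=> p0 [q0 [_ [/eqP qA <-] l]]; rewrite coll_eqNone in qA.
have := valP e; rewrite (trim_link _ _ l) qA => /and3P[_ _] /=.
by case: (a); case: (q0.2).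
Qed.

Lemma walk_trim_end (G : bidigraph) (a : bool) (A : {set G})
    (B : {set quot (coll A) (trim a A)}) p es q :
  walk B p es q -> (p.1 = None -> p.2 = a) -> q.1 = None -> q.2 = a.
Proof.
elim: es p => [p /eqP->|e es IH p /walk_consP[_ [m l w]] _] //.
by apply: IH w _ => mN; move: l; rewrite /neg mN => /trim_link_None/negb_inj.
Qed.

(** * Peeling the trunk off a semiradial with trivial core *)

Section Decomposition.
Variables (a : bool) (G : bidigraph) (s : G).
Hypothesis semi_s : semiradial a s.
Hypothesis loopless_s : forall (e : edge G) b c, ~~ link e (s, b) (s, c).
Hypothesis core_s : core s = [set s].

Lemma root_link e v g c :
  link e (v, g) (s, c) ->
  [/\ v != s, g = a & forall d, ~~ reach [set: G] (v, ~~ a) (s, d)].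
Proof.
move=> l; have vs : v != s.
  by apply/eqP=> E; move: l; rewrite E (negPf (loopless_s _ _ _)).
have N : ~ exists d, reach [set: G] (v, ~~ g) (s, d).
  by move/(adjacent_core vs l); rewrite core_s inE (negPf vs).
have Eg : g = a.
  apply/eqP/negPn/negP=> ga; case: N.
  have -> : ~~ g = a by case: (g) (a) ga => -[].
  by have /semiradialP := semi_s.
by split=> // d; apply/negP=> Hd; case: N; exists d; rewrite Eg.
Qed.

(** The set X of the opening comment. The root is added explicitly, since its trivial ditrail counts
    for both signs. *)
Definition oneway : {set G} :=
  [set x | (x == s) || [forall c, ~~ reach [set: G] (x, ~~ a) (s, c)]].

(** For [x = s], a first edge would arrive at a neighbour with sign [a] by [root_link], and the rest
    would leave that neighbour with the forbidden sign [~~ a]. *)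
Lemma oneway_trail x es c :
  x \in oneway -> uniq es -> walk [set: G] (x, ~~ a) es (s, c) -> es = [::].
Proof.
rewrite inE => /orP[/eqP->|/forallP/(_ c)/negP xN u w]; last first.
  by case: xN; apply/reachP; exists es.
case: es => // e es /= /andP[_ u] /andP[_ /existsP[m /andP[l w]]].
have [_ Em /(_ c)/negP[]] := root_link (etrans (linkC _ _ _) l).
by apply/reachP; exists es => //; rewrite -Em negbK -surjective_pairing.
Qed.

Definition trunk : {set G} :=
  [set x in oneway | [exists c, reach oneway (x, a) (s, c)]].

Lemma trunk_oneway x : x \in trunk -> x \in oneway.
Proof. by rewrite inE => /andP[]. Qed.

Lemma root_oneway : s \in oneway. Proof. by rewrite inE eqxx. Qed.

Lemma root_trunk : s \in trunk.
Proof.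
by rewrite inE root_oneway; apply/existsP; exists a; apply: reach_refl.
Qed.

(** By [oneway_trail] every nonempty final segment leaves with sign [a], so it witnesses that its
    first vertex is in the trunk. *)
Lemma walk_oneway_trunk p es c :
  uniq es -> walk oneway p es (s, c) -> walk trunk p es (s, c).
Proof.
elim: es p => // e es IH p u w.
have pT : p.1 \in trunk.
  have [pO _] := walk_consP _ _ _ _ _ w.
  have p2 : p.2 = a.
    apply/eqP/negPn/negP=> pa.
    have E : p = (p.1, ~~ a).
      by rewrite [LHS]surjective_pairing; case: (p.2) (a) pa => -[].
    rewrite E in w.
    by have := oneway_trail pO u (walk_sub (subsetT _) w).
  rewrite inE pO; apply/existsP; exists c; apply/reachP; exists (e :: es) => //.
  by rewrite -p2 -surjective_pairing.
have [_ [m l wm]] := walk_consP _ _ _ _ _ w.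
apply/walk_consP; split=> //; exists m => //; apply: IH wm.
by case/andP: u.
Qed.

Lemma trunk_reach x : x \in trunk -> exists c, reach trunk (x, a) (s, c).
Proof.
rewrite inE => /andP[_ /existsP[c /reachP[es u w]]]; exists c.
by apply/reachP; exists es => //; apply: walk_oneway_trunk.
Qed.

(** Otherwise [e], which is not inside the trunk, could be put before a ditrail from [x] to [s]
    inside the trunk, and [v] would belong to the trunk. *)
Lemma link_trunk e v g x c :
  v \in oneway -> x \in trunk -> v \notin trunk ->
  link e (v, g) (x, c) -> g = a -> c = ~~ a -> False.
Proof.
move=> vO xT vT l Eg Ec; case/negP: (vT).
have [d /reachP[es u w]] := trunk_reach xT.
rewrite inE vO; apply/existsP; exists d; apply/reachP; exists (e :: es).
  rewrite /= u andbT; apply/negP=> ees.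
  have := walk_inside (q := (s, d)) root_trunk w.
  by move/allP/(_ e ees); rewrite (inside_link _ l) /= (negPf vT).
apply/walk_consP; split=> //; exists (x, a); first by move: l; rewrite Eg Ec.
by apply: walk_sub w; apply/subsetP=> y /trunk_oneway.
Qed.

Lemma root_link_trunk e v g c : link e (v, g) (s, c) -> v \in trunk.
Proof.
move=> l; have [vs Eg vN] := root_link l.
have vO : v \in oneway by rewrite inE; apply/orP; right; apply/forallP.
rewrite inE vO; apply/existsP; exists (~~ c); apply/reachP; exists [:: e] => //.
apply/walk_consP; split=> //.
by exists (s, ~~ c); rewrite /neg /= ?negbK -?Eg ?eqxx.
Qed.

Lemma trunk_linear :
  linear_semiradial a (Sub s root_trunk : induced (Sub s root_trunk)).
Proof.
set s0 := Sub s _; split.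
- apply/semiradialP=> v; have [c H] := trunk_reach (valP v).
  by exists c; apply: reach_induced.
- move=> e b c; apply/negP=> /induced_link /=.
  exact/negP/loopless_s.
move=> x w H; have [c [u wk]] : exists c,
    uniq (map (@step_edge (induced s0)) w) /\
    walk setT (x, ~~ a) (map (@step_edge (induced s0)) w) (s0, c).
  by case/orP: H => /signed_ditrail_walk H; [exists false | exists true].
have := @walk_hom _ _ _ _ _ setT _ _ _ (@induced_link _ _ s0) _ wk.
move=> /(_ (fun _ _ => in_setT _))/oneway_trail E.
have : map val (map (@step_edge (induced s0)) w) = [::].
  apply: E; first exact/trunk_oneway/(valP x).
  by rewrite (map_inj_uniq val_inj).
by case: w {H u wk E}.
Qed.

Lemma walk_last A p es q :
  p.1 \notin trunk -> walk A p es q -> A \subset ~: trunk ->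
  q.1 \in trunk ->
  exists e p', p'.1 \notin trunk /\ link e p' (neg q).
Proof.
move=> pN w /subsetP AT qT; elim: es p pN w => [p pN /eqP E|e es IH p pN].
  by rewrite E qT in pN.
case/walk_consP=> _ [m l w].
have [mT|mT] := boolP (m.1 \in trunk); last exact: IH w.
exists e, p; split=> //.
case: es {IH} w => [/eqP<- //|e' es /walk_consP[/AT]].
by rewrite inE mT.
Qed.

(** * The trimmed contraction of the trunk and its core *)

Local Notation trimmed := (quot (coll trunk) (trim a trunk)).

(** Cut the ditrail at its first trunk vertex [m]. All neighbours of [s] are in the trunk, so [m] is
    not [s]; as [m] has no ditrail to [s] leaving with [~~ a], its state sign is [a] and no edge
    used is trimmed. *)
Lemma reach_trimmed z b c :
  z \notin trunk -> reach [set: G] (z, b) (s, c) ->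
  @reach trimmed setT (coll trunk z, b) (None, a).
Proof.
move=> zT /reachP[es0 u0 w0].
have [es [m [es2 [Ees w mT w2]]]] := walk_first_hit (q := (s, c)) root_trunk w0.
have [ue ue2] : uniq es /\ uniq es2.
  by move: u0; rewrite Ees cat_uniq => /and3P[].
rewrite setTD in w.
have ms : m.1 != s.
  apply/eqP=> Em.
  have [e [p [pN]]] := walk_last (p := (z, b)) zT w (subxx _) mT.
  rewrite /neg Em [p]surjective_pairing => /root_link_trunk.
  exact/negP.
have m2 : m.2 = a.
  apply/eqP/negPn/negP=> ma.
  have := trunk_oneway mT; rewrite inE (negPf ms) /= => /forallP/(_ c)/negP[].
  apply/reachP; exists es2 => //.
  have <- : m = (m.1, ~~ a); last by [].
  by rewrite [LHS]surjective_pairing; case: (m.2) (a) ma => -[].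
have <- : himg (coll trunk) m = (None, a) by rewrite /himg coll_None ?m2.
apply: (@reach_quot _ _ _ _ (~: trunk) _ (z, b)) => [x _|es' w'|].
- by rewrite inE.
- exact: walk_trim w'.
by apply/reachP; exists es.
Qed.

(** Up to its first return to [None], such a ditrail lifts to one between trunk vertices that leaves
    with sign [~~ a]. Continued to [s] inside the trunk, it contradicts [oneway_trail]. *)
Lemma trimmed_no_closed : ~~ @reach trimmed setT (None, ~~ a) (None, a).
Proof.
apply/negP=> /reachP[[|e es0] u0]; first by move=> /eqP[]; case: (a).
case/walk_consP=> _ [m l w0].
have m0 : m.1 <> None.
  move=> mN; rewrite /neg mN in l.
  by move: l; rewrite (negPf (contract_loop _ _ _ _)) //; apply: trim_outside.
have [es [n [es2 [Ees w /set1P/= nN _]]]] :=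
  walk_first_hit (q := (None : trimmed, a)) (set11 _) w0.
have u : uniq (e :: es).
  by move: u0; rewrite Ees -cat_cons cat_uniq => /and3P[].
have n2 : n.2 = a by apply: walk_trim_end w _ nN.
have [p0 [q0 [[/eqP p0N p02] Eq0 l0]]] := link_quot l.
rewrite coll_eqNone in p0N.
have nB : None \notin [set: trimmed] :\: [set None] by rewrite !inE eqxx.
have Em : himg (coll trunk) (neg q0) = m by rewrite -[m]negK -Eq0.
have [q Eq wq] := coll_himg_lift nB w Em.
have qT : q.1 \in trunk.
  by rewrite -coll_eqNone -[coll _ _]/(himg (coll trunk) q).1 Eq nN.
have [c /reachP[es3 u3 w3]] := trunk_reach qT.
have q2 : q.2 = a by rewrite -n2 -Eq.
rewrite -q2 -surjective_pairing in w3.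
suff: val e :: map val es ++ es3 = [::] by [].
apply: (oneway_trail (c := c) (trunk_oneway p0N)).
  rewrite -cat_cons -map_cons; apply: (@uniq_split_cat _ (inside trunk)) u3.
  - by apply/allP=> _ /mapP[x _ ->]; apply/trim_outside/(valP x).
  - exact: (walk_inside (q := (s, c)) root_trunk w3).
  by rewrite (map_inj_uniq val_inj).
apply/walk_consP; split; first by rewrite inE.
rewrite -p02 -surjective_pairing; exists (neg q0); first by rewrite negK.
exact: walk_cat (walk_sub (subsetT _) wq) (walk_sub (subsetT _) w3).
Qed.

Lemma trimmed_semiradial : semiradial a (None : trimmed).
Proof.
apply/semiradialP=> -[u|]; last by exists a; apply: reach_refl.
have [c] := (semiradialP _ _).1 semi_s (val u).
by move/(reach_trimmed (valP u)); rewrite coll_val => H; exists a.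
Qed.

(** By [adjacent_core] it suffices to leave [v] with sign [~~ g]. If [g] is not [a], the semiradial
    does this; if [g = a], then [link_trunk] puts [v] outside [oneway], which gives a ditrail
    leaving with [~~ a]. *)
Lemma trimmed_link_core (e : edge trimmed) v g c :
  @link trimmed e (v, g) (None, c) -> v \in core (None : trimmed).
Proof.
case: v => [u|] l; last exact: core_root.
apply: (adjacent_core _ l) => //; exists a.
have [Eg|ga] := eqVneq g a; last first.
  have -> : ~~ g = a by case: (g) (a) ga => -[].
  have [c'] := (semiradialP _ _).1 semi_s (val u).
  by move/(reach_trimmed (valP u)); rewrite coll_val.
have uO : val u \notin oneway.
  apply/negP=> uO; have Ec := trim_link_None l.
  have [[x b] [[y d] [[Ex Eb] [/eqP yT Ed] l0]]] := link_quot l.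
  rewrite coll_eqNone in yT.
  have xu : x = val u.
    by apply: (@coll_inj _ trunk); rewrite Ex // -coll_val.
  apply: (link_trunk (v := x)) yT _ l0 _ _; rewrite ?xu //.
  - exact: (valP u).
  - by rewrite Eb.
  by rewrite Ed.
move: uO; rewrite inE negb_or => /andP[_ /forallPn[c' /negPn]].
by rewrite Eg => /(reach_trimmed (valP u)); rewrite coll_val.
Qed.

Local Notation W := (core (None : trimmed)).
Let w0 : {x : trimmed | x \in W} := Sub (None : trimmed) (core_root _).

(** The core offers ditrails to [None] leaving with either sign, and [walk_trim_end] forces each to
    arrive with sign [~~ a]. *)
Lemma trimmed_core_almost_strong : almost_strong_radial a (w0 : induced w0).
Proof.
have H (v : induced w0) b : (val v = None -> b = a) ->
    reach [set: induced w0] (v, b) (w0, a).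
  move=> vb.
  have [_ /(_ _ b (valP v))[c]] :=
    absoluteP _ _ (absolute_core (None : trimmed)).
  move=> R; apply: reach_induced; have Ec : c = a.
    by case/reachP: R => es _ w; apply: walk_trim_end w vb erefl.
  by move: R; rewrite Ec.
split=> [v|v vr|].
- apply/signed_ditrailP; rewrite negbK; exact: H.
- apply/signed_ditrailP; rewrite negbK; apply: H => vN.
  by case/eqP: vr; apply: val_inj.
move/signed_ditrailP; rewrite negbK => /induced_reach.
move/(reach_sub (subsetT _)); exact/negP/trimmed_no_closed.
Qed.

Lemma contract_trunk_calR :
  calL a (None : contract W) -> calR a (None : contract trunk).
Proof.
move=> KL.
have TR : calR a (None : trimmed).
  apply: (@calR_glue a (contract W) (induced w0) trimmed None w0 val) => //.
    exact: trimmed_core_almost_strong.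
  (* No edge leaving [W] attaches at [None], whose neighbours all lie in [W]. *)
  apply: gluing_sum_contract => e u v b c vW l; rewrite !inE.
  apply/eqP=> Eu; move: l; rewrite linkC Eu => /trimmed_link_core.
  exact/negP.
apply: (@calR_add_edges a trimmed (contract trunk) None id) => //.
exists (fun e => Sub (val e) (trim_outside (valP e))); split.
- by exists id.
- by move=> e f /(congr1 val); rewrite !SubK => /val_inj.
- by move=> e u v b c; rewrite /link.
(* An edge missing from the trimmed graph failed [trim] without being inside the trunk, so one of
   its trunk ends has sign [a]. *)
move=> e eN; have eT : ~~ trim a trunk (val e).
  apply/negP=> eT; case/negP: eN; apply/codomP; exists (Sub (val e) eT).
  exact: val_inj.
move: eT; have := valP e; rewrite /trim /inside.
case E: (ends (val e)) => [p q] /= -> /=; rewrite negb_and !negbK.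
case/orP=> /andP[pT /eqP pa].
  exists (coll trunk q.1), q.2; rewrite -[a in link _ (_, a)]pa.
  rewrite -(coll_None pT); apply: (@quot_link _ _ _ _ e p q).
  by rewrite /link E eqxx.
exists (coll trunk p.1), p.2; rewrite -[a in link _ (_, a)]pa.
rewrite -(coll_None pT); apply: (@quot_link _ _ _ _ e q p).
by rewrite /link E eqxx orbT.
Qed.

Lemma trunk_calL : calR a (None : contract trunk) -> calL a s.
Proof.
move=> KR.
apply: (@calL_glue a (contract trunk) (induced (Sub s root_trunk)) G None
          (Sub s root_trunk) val) => //.
  exact: trunk_linear.
apply: gluing_sum_contract => e u v b c vW l; rewrite !inE.
apply/eqP=> Eu; move: l; rewrite linkC Eu => /root_link_trunk.
exact/negP.
Qed.

(** Makes the induction below decrease. The first trunk vertex on a ditrail from outside the trunk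
    is not [s], whose neighbours are all in the trunk. *)
Lemma trunk_nontrivial v : v != s -> exists2 x, x \in trunk & x != s.
Proof.
move=> vs; have [vT|vT] := boolP (v \in trunk); first by exists v.
have [c /reachP[es _ wk]] := (semiradialP _ _).1 semi_s v.
have [es1 [m [es2 [_ w mT _]]]] := walk_first_hit (q := (s, c)) root_trunk wk.
rewrite setTD in w; exists m.1 => //; apply/eqP=> Em.
have [e [p [pN]]] := walk_last (p := (v, a)) vT w (subxx _) mT.
rewrite /neg Em [p]surjective_pairing => /root_link_trunk.
exact/negP.
Qed.

End Decomposition.

(** * Induction on the number of vertices *)

Lemma card_option_notin (T : finType) (A : {set T}) :
  #|{: option {x : T | x \notin A}}| = (#|T| - #|A|).+1.
Proof.
rewrite card_option card_sig; congr S.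
by rewrite -(cardsC A) addKn; apply: eq_card => y; rewrite !inE.
Qed.

Lemma core_trivial_calL (a : bool) (G : bidigraph) (s : G) :
  semiradial a s -> (forall (e : edge G) b c, ~~ link e (s, b) (s, c)) ->
  core s = [set s] -> calL a s.
Proof.
have [n] := ubnP #|G|; elim: n => // n IH in G s * => /ltnSE leGn sr nl cs.
have [/existsP[v vs]|] := boolP [exists v, v != s]; last first.
  rewrite negb_exists => /forallP all_s.
  have Es x : x = s by apply/eqP/negPn/all_s.
  apply: calL_linear; split=> // x w H.
  have [c [u wk]] : exists c, uniq (map (@step_edge G) w) /\
      walk setT (x, ~~ a) (map (@step_edge G) w) (s, c).
    by case/orP: H => /signed_ditrail_walk H; [exists false | exists true].
  case: w wk {H u} => //= t w /andP[_ /existsP[m /andP[l _]]].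
  by rewrite /neg (Es x) (Es m.1) (negPf (nl _ _ _)) in l.
apply: trunk_calL => //; apply: contract_trunk_calR => //.
apply: IH => [||e b c|].
(* Contracting a set of size k removes k - 1 vertices. The trunk has at least two vertices and [W]
   at least one, so the total drops. *)
- set W := core _; have W0 : 0 < #|W|.
    by apply/card_gt0P; exists None; apply: core_root.
  have T1 : 1 < #|trunk a s|.
    have [x xT xs] := trunk_nontrivial sr nl cs vs.
    rewrite (cardsD1 s) root_trunk ltnS; apply/card_gt0P; exists x.
    by rewrite in_setD1 xs.
  have -> : #|contract W| = _ := card_option_notin W.
  have -> : #|quot (coll (trunk a s)) _| = _ := card_option_notin (trunk a s).
  have TG : #|trunk a s| <= #|G| := max_card _.
  move: (#|W|) (#|trunk a s|) (#|G|) W0 T1 TG leGn => w t g.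
  lia.
- exact: semiradial_contract (core_root _) (trimmed_semiradial sr nl cs).
- exact: contract_loop.
by apply: (@core_contract _ _ (fun e => ~~ inside _ e)).
Qed.
(** * Ditrails in gluing sums *)

Lemma reach_root (G : bidigraph) (r v : G) b c :
  reach [set: G] (v, b) (r, c) ->
  exists d, reach (~: [set r]) (v, b) (r, d) /\ reach [set: G] (r, d) (r, c).
Proof.
case/reachP=> es0 u0 w0.
have [es [m [es2 [E w /set1P mr w2]]]] :=
  walk_first_hit (q := (r, c)) (set11 r) w0.
have [u u2] : uniq es /\ uniq es2 by move: u0; rewrite E cat_uniq => /and3P[].
have Em : m = (r, m.2) by rewrite [LHS]surjective_pairing mr.
rewrite setTD in w; rewrite Em in w w2.
by exists m.2; split; apply/reachP; [exists es | exists es2].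
Qed.

Lemma semiradial_reach_root (G : bidigraph) (a : bool) (r : G) :
  semiradial a r -> forall v, exists c, reach (~: [set r]) (v, a) (r, c).
Proof.
by move=> /semiradialP H v; have [c /reach_root[d []]] := H v; exists d.
Qed.

(** Cut a ditrail arriving at [r] with sign [~~ a] at its first visit of [r]. Had it first arrived
    with sign [a], the rest would be a forbidden closed ditrail over [r]. *)
Lemma almost_strong_reach_root (G : bidigraph) (a : bool) (r : G) :
  almost_strong_radial a r ->
  forall v b, v != r -> reach (~: [set r]) (v, b) (r, a).
Proof.
case=> rad str ncl v b vr.
have [d [H1 H2]] : exists d, reach (~: [set r]) (v, b) (r, d) /\
    reach [set: G] (r, d) (r, a).
  apply: reach_root; rewrite -[a in (r, a)]negbK; apply/signed_ditrailP.
  have [->|ba] := eqVneq b a; first exact: rad.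
  have -> : b = ~~ a by case: b a ba {rad str ncl} => -[].
  exact: str.
have [<- //|da] := eqVneq d a; case: ncl; apply/signed_ditrailP.
rewrite negbK; suff <- : d = ~~ a by [].
by case: d a da {H1 H2 rad str} => -[].
Qed.

(** Only ditrails that meet [s] just at their end are transferred: at an intermediate visit the two
    edges at [s] may be reattached to different vertices of [T]. The vertex [t] depends on the last
    edge, so every continuation from [t] is allowed. *)
Lemma gluing_reach (G H Gh : bidigraph) (s : G) (T : {set H}) (jH : H -> Gh)
    (r : H) :
  gluing_sum s T jH ->
  (forall u v b c, reach (~: [set r]) (u, b) (v, c) ->
     reach (~: [set jH r]) (jH u, b) (jH v, c)) /\
  (forall x, (exists v, x = jH v) \/
     exists2 v, v != s & forall b c, reach (~: [set s]) (v, b) (s, c) ->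
       exists2 t, t \in T & forall w d, reach (~: [set r]) (t, c) (w, d) ->
         reach (~: [set jH r]) (x, b) (jH w, d)).
Proof.
case=> jG [f [[bV bE] [eH eG eS _]]].
have [inv invK Kinv] := bV; have fI := bij_inj bE.
have jHI : injective jH.
  by move=> u v E; have [] := bij_inj bV (x1 := inr u) (x2 := inr v) E.
have jGH v u : v != s -> jG v != jH u.
  move=> vs; apply/eqP=> E.
  by have := bij_inj bV (x1 := inl (Sub v vs)) (x2 := inr u) E.
have HH p es q : walk (~: [set r]) p es q ->
    walk (~: [set jH r]) (jH p.1, p.2) (map (f \o inr) es) (jH q.1, q.2).
  apply: walk_hom => [e p' q'|x].
    by rewrite [p']surjective_pairing [q']surjective_pairing => /eH.
  by rewrite !inE (inj_eq jHI).
split=> [u v b c /reachP[es ue w]|x].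
  apply/reachP; exists (map (f \o inr) es); last exact: HH w.
  by rewrite map_inj_uniq // => e e' /fI[].
rewrite -[x]Kinv; case: (inv x) => [u|u]; [right | by left; exists u].
exists (val u) => [|b c]; first exact: (valP u).
case/reachP=> es1 u1 w1.
have [t tT wt] : exists2 t, t \in T & walk (~: [set jH r]) (jG (val u), b)
    (map (f \o inl) es1) (jH t, c).
  have : (val u, b).1 != s by apply: (valP u).
  (* Vertex and sign become projections of one state, so that the induction can vary it. *)
  rewrite -[jG (val u)]/(jG (val u, b).1) -[b in (jG _, b)]/(val u, b).2.
  elim: es1 (val u, b) w1 {u1} => [p /eqP->|e es IH p]; first by rewrite eqxx.
  case/walk_consP=> _ [m l w] ps.
  have pr : jG p.1 \in ~: [set jH r] by rewrite !inE jGH.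
  have [ms|ms] := eqVneq m.1 s.
    case: es {IH} w => [/eqP Em|e' es /walk_consP[]]; last first.
      by rewrite !inE ms eqxx.
    have := eS e p.1 (~~ c) p.2 ps.
    rewrite linkC -surjective_pairing -[(s, ~~ c)]/(neg (s, c)) -Em.
    move=> /(_ l)[t tT lt].
    exists t => //; apply/walk_consP; split=> //; exists (jH t, c) => //=.
    by rewrite linkC.
  have [t tT wt] := IH m w ms; exists t => //.
  apply/walk_consP; split=> //; exists (jG m.1, m.2) => //.
  by apply: eG => //; rewrite -surjective_pairing.
exists t => // w d /reachP[es2 u2 w2]; apply/reachP.
exists (map (f \o inl) es1 ++ map (f \o inr) es2).
  rewrite (map_comp f inl) (map_comp f inr) -map_cat map_inj_uniq // cat_uniq.
  rewrite !map_inj_uniq ?u1 ?u2 ?andbT //=; try by move=> ? ? [].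
  by apply/hasPn=> _ /mapP[e _ ->]; apply/mapP=> -[].
exact: walk_cat wt (HH _ _ _ w2).
Qed.

Scheme calR_mind := Minimality for calR Sort Prop
with calL_mind := Minimality for calL Sort Prop.
Combined Scheme calRL_ind from calR_mind, calL_mind.

(** The two claims feed each other: ditrails from [calL] arrive with an unknown sign, but an almost
    strong radial continues from [t != r] with either sign; those from [calR] arrive in state [a],
    which a linear semiradial continues. *)
Lemma calRL_reach_root (a : bool) :
  (forall (G : bidigraph) (r : G), calR a r ->
     forall v, v != r -> reach (~: [set r]) (v, a) (r, a)) /\
  (forall (G : bidigraph) (r : G), calL a r ->
     forall v, exists c, reach (~: [set r]) (v, a) (r, c)).
Proof.
apply: calRL_ind => [G r|G G' r jV _ IH|G H Gh s r jH _ IH ast|G r|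
                     G H Gh s r jH _ IH].
- by move/almost_strong_reach_root=> H v; apply: H.
- case=> jE [bV iE lE _] v'; have [inv invK Kinv] := bV.
  rewrite -[v']Kinv (inj_eq (bij_inj bV)) => vr.
  have /reachP[es u w] := IH _ vr; apply/reachP; exists (map jE es).
    by rewrite map_inj_uniq.
  apply: walk_hom w => [e p q|x].
    by rewrite [p]surjective_pairing [q]surjective_pairing => /lE.
  by rewrite !inE (inj_eq (bij_inj bV)).
- have strong := almost_strong_reach_root ast.
  case/(gluing_reach r)=> HH HG x; have [[v ->]|[v vs Hv] _] := HG x.
    move=> vr; apply: HH; apply: strong; by apply: contraNneq vr => ->.
  have [c /Hv[t tT Ht]] := IH v; apply: Ht; apply: strong.
  by rewrite !inE in tT.
- by case=> sr _ _; apply: semiradial_reach_root.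
case=> /semiradial_reach_root sr _ _ /(gluing_reach r)[HH HG] x.
have [[v ->]|[v vs Hv]] := HG x.
  by have [c Hc] := sr v; exists c; apply: HH.
have [t _ Ht] := Hv _ _ (IH v vs).
by have [c Hc] := sr t; exists c; apply: Ht.
Qed.

Theorem theorem11p3 (a : bool) (Gh : bidigraph) (r : Gh) :
  semiradial a r <->
  exists (G H : bidigraph) (s : G) (r0 : H) (jH : H -> Gh),
    [/\ calL a s, absolute_semiradial r0, gluing_sum s [set: H] jH
      & jH r0 = r].
Proof.
split=> [sr|[G [H [s [r0 [jH [GL abs_r0 gl <-]]]]]]].
  pose r0 : {x : Gh | x \in core r} := Sub r (core_root r).
  exists (contract (core r)), (induced r0), None, r0, val; split=> //.
  - apply: core_trivial_calL.
    + exact: semiradial_contract (core_root r) sr.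
    + by move=> e b c; apply: contract_loop.
    by apply: (@core_contract _ _ (fun e => ~~ inside _ e)).
  - exact: core_semiradial.
  by apply: gluing_sum_contract => *; rewrite inE.
have [HH HG] := gluing_reach r0 gl.
apply/semiradialP=> x.
suff [c Hc] : exists c, reach (~: [set jH r0]) (x, a) (jH r0, c).
  by exists c; apply: reach_sub (subsetT _) Hc.
have [[v ->]|[v vs Hv]] := HG x.
  by have [c Hc] := semiradial_reach_root (abs_r0 a) v; exists c; apply: HH.
(* The state sign [c] at [t] is not controlled; the absolute semiradial continues with either
   sign. *)
have [c /Hv[t _ Ht]] := (calRL_reach_root a).2 _ _ GL v.
by have [d Hd] := semiradial_reach_root (abs_r0 c) t; exists d; apply: Ht.
Qed.
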